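(* Every unitarily antidiagonalizable complex matrix $M$ has a quasidiagonal Schur form; that is, there are a unitary matrix $U$ and a matrix $S$ that is both upper triangular and quasidiagonal, with the eigenvalues of $M$ on its diagonal, such that $M=USU^{-1}$.
   Context: An antidiagonal matrix of size $n$ has nonzero entries only at positions $(i,n+1-i)$. $M$ is unitarily antidiagonalizable if $M=VAV^{-1}$ with $V$ unitary and $A$ antidiagonal. A matrix is quasidiagonal if it is block diagonal with square diagonal blocks of size at most $2$. A Schur decomposition of $M$ is $M=UTU^{-1}$ with $U$ unitary and $T$ (the Schur form) upper triangular with diagonal consisting of the eigenvalues of $M$. *)

(* Defs.v *)
From HB Require Import structures.
From mathcomp Require Import all_boot all_order all_algebra.
From mathcomp Require Import spectral complex reals.

Set Implicit Arguments.
Unset Strict Implicit.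
Unset Printing Implicit Defensive.

Import Order.TTheory GRing.Theory Num.Theory.

Local Open Scope ring_scope.

(* With indices starting at 0, the antidiagonal consists of the positions
   (i, n - 1 - i), and [rev_ord i] is n - 1 - i. *)
Definition is_antidiag_mx (K : nzRingType) (n : nat) (A : 'M[K]_n) : Prop :=
  forall i j : 'I_n, A i j != 0 -> j = rev_ord i.

Definition unitarily_antidiagonalizable (C : numClosedFieldType) (n : nat)
    (M : 'M[C]_n) : Prop :=
  exists V A : 'M[C]_n,
    [/\ V \is unitarymx, is_antidiag_mx A & M = V *m A *m invmx V].

Definition is_quasidiag_mx (K : nzRingType) (n : nat) (S : 'M[K]_n) : Prop :=
  exists (k : nat) (p : 'I_k -> nat) (B : forall i : 'I_k, 'M[K]_(p i))
         (eq_n : (\sum_i p i)%N = n),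
    (forall i : 'I_k, (0 < p i <= 2)%N) /\
    S = castmx (eq_n, eq_n) (\mxdiag_i B i).

(* [is_trig_mx] means lower triangular, hence the transpose. *)
Definition is_upper_trig_mx (K : nzRingType) (n : nat) (T : 'M[K]_n) : bool :=
  is_trig_mx T^T.

(* The second clause adds that each eigenvalue is repeated according to its
   algebraic multiplicity. *)
Definition diag_is_spectrum (K : fieldType) (n : nat) (M T : 'M[K]_n) : Prop :=
  (forall a : K, eigenvalue M a <-> exists i : 'I_n, T i i = a) /\
  char_poly M = \prod_(i < n) ('X - (T i i)%:P).

Definition is_schur_decomposition (C : numClosedFieldType) (n : nat)
    (M U T : 'M[C]_n) : Prop :=
  [/\ U \is unitarymx, is_upper_trig_mx T, diag_is_spectrum M T
    & M = U *m T *m invmx U].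

(* Main.v *)
(* Permuting the index pair (first, last) to the front is a unitary conjugation
   which splits an antidiagonal matrix of size n + 2 into a direct sum of a 2x2
   block and an antidiagonal matrix of size n.  Iterating, an antidiagonal matrix
   is unitarily similar to a direct sum of blocks of size at most 2, and each
   block is triangularized separately by Schur's theorem. *)
Require Import Defs.
From HB Require Import structures.
From mathcomp Require Import all_boot all_order all_algebra.
From mathcomp Require Import perm zify.
From mathcomp Require Import spectral complex reals boolp.

Set Implicit Arguments.
Unset Strict Implicit.
Unset Printing Implicit Defensive.

Import Order.TTheory GRing.Theory Num.Theory.

Local Open Scope ring_scope.

Section Quasidiag.

Variable K : nzRingType.

(* Packing a matrix with its size turns the casts in [is_quasidiag_mx] into
   plain equalities. *)
Local Notation sqmx := {m : nat & 'M[K]_m}.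

Definition direct_sum_mx (k : nat) (B : 'I_k -> sqmx) : sqmx :=
  Tagged (fun m => 'M[K]_m) (\mxdiag_i tagged (B i)).

Lemma direct_sum_mx_recl (k : nat) (B : 'I_k.+1 -> sqmx) :
  direct_sum_mx B =
  Tagged (fun m => 'M[K]_m)
    (block_mx (tagged (B ord0)) 0 0
              (tagged (direct_sum_mx (fun i => B (lift ord0 i))))).
Proof.
rewrite /direct_sum_mx (mxdiag_recl (fun i => tagged (B i))).
by case: _ / mxsize_recl; rewrite castmx_id.
Qed.

Lemma is_quasidiag_mxP (n : nat) (S : 'M[K]_n) :
  is_quasidiag_mx S <->
  exists (k : nat) (B : 'I_k -> sqmx),
    (forall i, (0 < tag (B i) <= 2)%N) /\
    Tagged (fun m => 'M[K]_m) S = direct_sum_mx B.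
Proof.
split=> [[k [p [B [eq_n [p_le2 ->]]]]]|[k [B [B_le2 eqS]]]].
  exists k, (fun i => Tagged (fun m => 'M[K]_m) (B i)); split=> //.
  by case: _ / eq_n; rewrite castmx_id.
exists k, (fun i => tag (B i)), (fun i => tagged (B i)).
exists (esym (congr1 (@tag _ _) eqS)); split=> //.
(* The right-hand side of [eqS] is not a variable, so [eqS] cannot be eliminated directly.
   Generalizing to an arbitrary [T] and an arbitrary size proof [e'] lets the equality be
   destructed, leaving a trivial cast. *)
have: forall (T : sqmx) (e : Tagged (fun m => 'M[K]_m) S = T)
    (e' : tag T = n), S = castmx (e', e') (tagged T).
  by move=> T <- /= e'; rewrite castmx_id.
by move=> /(_ _ eqS); apply.
Qed.

Lemma is_quasidiag_mx0 (S : 'M[K]_0) : is_quasidiag_mx S.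
Proof.
exists 0%N, (fun=> 0%N), (fun=> 0).
by exists (big_ord0 _ _ _ _); split=> [[]//|]; rewrite [LHS]flatmx0 [RHS]flatmx0.
Qed.

Lemma is_quasidiag_block_mx (m n : nat) (A : 'M[K]_m) (S : 'M[K]_n) :
  (0 < m <= 2)%N -> is_quasidiag_mx S -> is_quasidiag_mx (block_mx A 0 0 S).
Proof.
move=> m_le2 /is_quasidiag_mxP [k [B [B_le2 eqS]]]; apply/is_quasidiag_mxP.
pose B' (i : 'I_k.+1) :=
  if unlift ord0 i is Some j then B j else Tagged (fun m => 'M[K]_m) A.
exists k.+1, B'; split=> [i|]; first by rewrite /B'; case: unliftP.
have B'_lift : (fun i => B' (lift ord0 i)) = B.
  by apply/funext => i; rewrite /B' liftK.
by rewrite direct_sum_mx_recl B'_lift -eqS /B' unlift_none.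
Qed.

End Quasidiag.

Lemma invmxM (R : comUnitRingType) (n : nat) (A B : 'M[R]_n) : A \in unitmx -> B \in unitmx ->
  invmx (A *m B) = invmx B *m invmx A.
Proof.
move=> Au Bu; have ABu : A *m B \in unitmx by rewrite unitmx_mul Au.
apply: (can_inj (mulKmx ABu)).
by rewrite mulmxV // mulmxA mulmxK // mulmxV.
Qed.

(** The scalar matrix ['X%:M] is central, so the characteristic matrix is itself conjugated by the
    constant matrix [P U], and the determinant does not see this. *)
Lemma char_poly_conj (R : comUnitRingType) (n : nat) (U S : 'M[R]_n) : U \in unitmx ->
  char_poly (U *m S *m invmx U) = char_poly S.
Proof.
move=> Uu; pose P (A : 'M[R]_n) := map_mx (@polyC R) A.
have PU : P U *m P (invmx U) = 1%:M by rewrite -map_mxM mulmxV // map_mx1.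
rewrite /char_poly.
have -> : char_poly_mx (U *m S *m invmx U) =
          P U *m char_poly_mx S *m P (invmx U).
  rewrite /char_poly_mx mulmxBr mulmxBl -!map_mxM.
  by rewrite scalar_mxC -(mulmxA 'X%:M) PU mulmx1.
by rewrite !det_mulmx mulrAC -det_mulmx PU det1 mul1r.
Qed.

Lemma upper_trig_diag_is_spectrum (F : fieldType) (n : nat) (U S : 'M[F]_n) :
  U \in unitmx -> is_upper_trig_mx S ->
  diag_is_spectrum (U *m S *m invmx U) S.
Proof.
move=> Uu trigS.
have eq_char : char_poly (U *m S *m invmx U) = \prod_(i < n) ('X - (S i i)%:P).
  (* [char_poly_trig] concerns lower triangular matrices, so the determinant is moved to the
     transpose. *)
  rewrite char_poly_conj // -[LHS]det_tr.
  have -> : (char_poly_mx S)^T = char_poly_mx S^T.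
    by rewrite /char_poly_mx raddfB /= tr_scalar_mx map_trmx.
  rewrite -/(char_poly _) char_poly_trig //.
  by apply: eq_bigr => i _; rewrite mxE.
split=> // a; rewrite eigenvalue_root_char eq_char.
rewrite -(big_map (fun i => S i i) xpredT (fun z => 'X - z%:P)) root_prod_XsubC.
split=> [/mapP [i _ ->]|[i <-]]; first by exists i.
by apply: map_f; rewrite mem_index_enum.
Qed.

Section QuasidiagSchur.

Variable C : numClosedFieldType.

Definition has_quasidiag_schur (n : nat) (M : 'M[C]_n) : Prop :=
  exists U S : 'M[C]_n,
    [/\ U \is unitarymx, is_upper_trig_mx S, is_quasidiag_mx S
      & M = U *m S *m invmx U].

(** [Schur] yields a lower triangular form; applying it to [M^T] and transposing the result gives an
    upper triangular one. *)
Lemma unitary_schur (n : nat) (M : 'M[C]_n) : (0 < n)%N ->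
  exists U T : 'M[C]_n,
    [/\ U \is unitarymx, is_upper_trig_mx T & M = U *m T *m invmx U].
Proof.
move=> n_gt0; have [P Pu] := Schur M^T n_gt0.
have Punit := unitarymx_unit Pu.
rewrite /similar_to conjumx // => trigL.
exists P^T, (P *m M^T *m invmx P)^T; split.
- by rewrite trmx_unitary.
- by rewrite /is_upper_trig_mx trmxK.
- by rewrite -trmx_inv -!trmx_mul mulmxKV // mulKmx // trmxK.
Qed.

Lemma unitarymx_invmx (n : nat) (U : 'M[C]_n) :
  U \is unitarymx -> invmx U \is unitarymx.
Proof. by move=> Uu; rewrite invmx_unitary // trmxC_unitary. Qed.

Lemma unitarymx_perm (n : nat) (s : 'S_n) : @perm_mx C n s \is unitarymx.
Proof.
by apply/unitarymxP; rewrite tr_perm_mx map_perm_mx -perm_mxM mulgV perm_mx1.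
Qed.

Lemma has_quasidiag_schur_conj (n : nat) (V M : 'M[C]_n) :
  V \is unitarymx -> has_quasidiag_schur M ->
  has_quasidiag_schur (V *m M *m invmx V).
Proof.
move=> Vu [U [S [Uu trigS qS ->]]]; exists (V *m U), S; split=> //.
  exact: mul_unitarymx.
by rewrite invmxM ?unitarymx_unit // !mulmxA.
Qed.

Lemma unitary_block_mx (m n : nat) (U : 'M[C]_m) (V : 'M[C]_n) :
  U \is unitarymx -> V \is unitarymx -> block_mx U 0 0 V \is unitarymx.
Proof.
move=> /unitarymxP Uu /unitarymxP Vu; apply/unitarymxP.
rewrite tr_block_mx map_block_mx mulmx_block !trmx0 !map_mx0.
by rewrite !(mulmx0, mul0mx) !(addr0, add0r) Uu Vu -scalar_mx_block.
Qed.

(** A block diagonal unitary acts on each summand alone, so the zero blocks survive, and the Schur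
    form of [A] is small enough to be a single diagonal block. *)
Lemma has_quasidiag_schur_block (m n : nat) (A : 'M[C]_m) (B : 'M[C]_n) :
  (0 < m <= 2)%N -> has_quasidiag_schur B ->
  has_quasidiag_schur (block_mx A 0 0 B).
Proof.
move=> m_le2 [V [S [Vu trigS qS ->]]].
have /andP[m_gt0 _] := m_le2; have [U [T [Uu trigT ->]]] := unitary_schur A m_gt0.
have UVu := unitary_block_mx Uu Vu.
exists (block_mx U 0 0 V), (block_mx T 0 0 S); split=> //.
- by rewrite /is_upper_trig_mx tr_block_mx !trmx0 is_trig_block_mx //; apply/and3P.
- exact: is_quasidiag_block_mx.
- rewrite !invmx_unitary // tr_block_mx map_block_mx !mulmx_block !trmx0 !map_mx0.
  by rewrite !(mulmx0, mul0mx, addr0, add0r).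
Qed.

Lemma antidiag_perm_block (n : nat) (A : 'M[C]_(2 + n)) : is_antidiag_mx A ->
  exists (s : 'S_(2 + n)) (B : 'M[C]_2) (A' : 'M[C]_n),
    is_antidiag_mx A' /\
    perm_mx s *m A *m invmx (perm_mx s) = block_mx B 0 0 A'.
Proof.
move=> antiA.
(* New indices 0 and 1 name the old first and last ones; the old indices 1 to n follow in order. *)
pose g (i : nat) := if i == 0%N then 0%N else if i == 1%N then n.+1 else i.-1.
pose f (i : 'I_(2 + n)) : 'I_(2 + n) := inord (g i).
have fE i : f i = g i :> nat.
  by rewrite inordK // /g; case: i => [[|[|i]] lt_i] //=; lia.
have f_inj : injective f.
  move=> i j /(congr1 val); rewrite /= !fE /g => eq_ij; apply: val_inj.
  by case: i j eq_ij => [[|[|i]] lt_i] [[|[|j]] lt_j] //=; lia.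
(* On the antidiagonal of size n + 2, row and column indices sum to n + 1. An index in {0, n + 1}
   and one in 1..n never do, which kills the off-diagonal blocks; in the trailing block both indices
   are shifted by 1, so there the sum is n - 1, the antidiagonal of size n. *)
have A_eq0 (i j : 'I_(2 + n)) : (g i + g j != n.+1)%N -> A (f i) (f j) = 0.
  apply: contraNeq => /antiA /(congr1 val); rewrite /= !fE => ->.
  by have := ltn_ord (f i); rewrite fE; lia.
pose s : 'S_(2 + n) := perm f_inj.
pose B : 'M[C]_(2 + n) := row_perm s (col_perm s A).
have BE i j : B i j = A (f i) (f j) by rewrite !mxE !permE.
have BP : perm_mx s *m A *m invmx (perm_mx s) = B.
  by rewrite /B row_permE col_permE mulmxA perm_mxV.
exists s, (ulsubmx B), (drsubmx B); split=> [i j|].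
  rewrite !mxE -/B; rewrite !permE => /(contra_neq (@A_eq0 _ _)) gij.
  apply: val_inj => /=; move: gij; rewrite /g /=; have := ltn_ord i; lia.
rewrite BP -[LHS]submxK; congr (block_mx _ _ _ _); apply/matrixP => i j;
  rewrite [LHS]mxE [LHS]mxE BE [RHS]mxE A_eq0 // /g /=.
  by case: i j => [[|[|i]] lt_i] [j lt_j] //=; lia.
by case: i j => [i lt_i] [[|[|j]] lt_j] //=; lia.
Qed.

Lemma antidiag_has_quasidiag_schur (n : nat) (A : 'M[C]_n) :
  is_antidiag_mx A -> has_quasidiag_schur A.
Proof.
elim/ltn_ind: n A => -[|[|n]] IHn A antiA.
- exists 1%:M, A; split; last by rewrite [LHS]flatmx0 [RHS]flatmx0.
  + by apply/unitarymxP; rewrite [LHS]flatmx0 [RHS]flatmx0.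
  + by apply/is_trig_mxP => -[].
  + exact: is_quasidiag_mx0.
(* The middle entry left over in odd size becomes a block of size 1 next to an empty matrix, so the
   block lemma applies again. *)
- have -> : A = block_mx (A : 'M_1) 0 0 (0 : 'M_0) :> 'M_(1 + 0).
    rewrite -[LHS](@submxK _ 1 0 1 0) [ursubmx _]thinmx0 [dlsubmx _]flatmx0.
    rewrite [drsubmx _]flatmx0; congr block_mx.
    by apply/matrixP => i j; rewrite !mxE !ord1; congr (A _ _); apply: val_inj.
  by apply: (@has_quasidiag_schur_block 1 0) => //; apply: IHn => // -[].
have [s [B [A' [antiA' eqB]]]] := antidiag_perm_block antiA.
have su := unitarymx_perm s; have sunit := unitarymx_unit su.
have -> : A = invmx (perm_mx s) *m (perm_mx s *m A *m invmx (perm_mx s))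
                *m invmx (invmx (perm_mx s)).
  by rewrite invmxK !mulmxA mulVmx // mul1mx mulmxKV.
apply: has_quasidiag_schur_conj; first exact: unitarymx_invmx.
by rewrite eqB; apply: (@has_quasidiag_schur_block 2 n) => //; apply: IHn.
Qed.

End QuasidiagSchur.

Theorem corollary6p3 (R : realType) (n : nat) (M : 'M[R[i]]_n) :
  unitarily_antidiagonalizable M ->
  exists U S : 'M[R[i]]_n,
    is_schur_decomposition M U S /\ is_quasidiag_mx S.
Proof.
move=> [V [A [Vu antiA ->]]].
have := has_quasidiag_schur_conj Vu (antidiag_has_quasidiag_schur antiA).
move=> [U [S [Uu trigS qS ->]]]; exists U, S; split=> //; split=> //.
exact: upper_trig_diag_is_spectrum (unitarymx_unit Uu) trigS.
Qed.
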